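(* Let $n \in \mathbb{N}$. If $\mathcal{B} = 2^{[n]} \setminus \mathcal{A}$ is the complement of a union-closed family $\mathcal{A} \subset 2^{[n]}$, then (i) $\sum_{B \in \mathcal{B}} |B| \leq \frac{n+1}{2}\, |\mathcal{B}|$, (ii) $\mu(\mathcal{B}) \leq \frac{n+1}{2n}\, |\mathcal{B}|$. In particular, if $n_l$, $l \in \mathbb{N}$, is a sequence of positive integers and $\mathcal{A}_l \subset 2^{[n_l]}$ is a sequence of union-closed families with $\mathcal{A}_l \neq \mathcal{A}_{l'}$ for $l \neq l'$, then the complements $\mathcal{B}_l = 2^{[n_l]} \setminus \mathcal{A}_l$ satisfy $$\limsup_{l \to \infty} \frac{\mu(\mathcal{B}_l)}{|\mathcal{B}_l|} \leq \frac{1}{2}.$$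
   Context: Here $\mathbb{N}$ denotes the positive integers. For $n \in \mathbb{N}$, $[n] = \{1, 2, \ldots, n\}$ and $2^{[n]} = \{A : A \subset [n]\}$ is the power set of $[n]$ (the symbol $\subset$ allows equality). A family $\mathcal{A} \subset 2^{[n]}$ is called union-closed if $A, B \in \mathcal{A}$ implies $A \cup B \in \mathcal{A}$. For a family $\mathcal{B} \subset 2^{[n]}$, $\mu(\mathcal{B}) = \frac{1}{n} \sum_{k=1}^{n} |\{B \in \mathcal{B} : k \in B\}|$ denotes the average over $k \in [n]$ of the number of members of $\mathcal{B}$ containing $k$; for $\mathcal{B}_l \subset 2^{[n_l]}$ this is taken with $n = n_l$. *)

(* Defs.v *)
From mathcomp Require Import all_boot all_order all_algebra finmap.
From mathcomp Require Import all_classical all_reals all_analysis.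

Set Implicit Arguments.
Unset Strict Implicit.
Unset Printing Implicit Defensive.

Import Order.TTheory GRing.Theory Num.Theory.

Local Open Scope ring_scope.
Local Open Scope fset_scope.

(* Families are finite sets of finite sets of naturals rather than terms of
   {set {set 'I_n}}, so that families on different ground sets [n] live in one
   type and can be compared for equality. *)
Definition setfamily := {fset {fset nat}}.

Definition ground (n : nat) : {fset nat} := [fset k in iota 1 n].

Definition cube (n : nat) : setfamily := fpowerset (ground n).

Definition union_closed (A : setfamily) : Prop :=
  forall X Y : {fset nat}, X \in A -> Y \in A -> X `|` Y \in A.

Definition compl_family (n : nat) (A : setfamily) : setfamily := cube n `\` A.

Definition mu (R : realType) (n : nat) (B : setfamily) : R :=
  (\sum_(1 <= k < n.+1) #|` [fset X in B | k \in X]|)%N%:R / n%:R.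

(* Main.v *)
(* A set X outside a union-closed family A has at most one element x with
   X \ x in A, as X is the union of any two sets of the form X \ x. So every X
   in the complement B has at least |X| - 1 neighbours X \ x in B, while
   X |-> X \ x injects the X in B with x in X and X \ x in B into the members
   of B avoiding x. Summing over X and x, sum |X| - |B| <= n |B| - sum |X|.
   For the limsup, only finitely many families live on [1..N], so distinct
   families force n_l to infinity. *)
Require Import Defs.
From mathcomp Require Import all_boot all_order all_algebra finmap.
From mathcomp Require Import all_classical all_reals all_analysis.
From mathcomp Require Import zify ring lra.

Import Order.TTheory GRing.Theory Num.Theory.

Local Open Scope ring_scope.
Local Open Scope fset_scope.

Lemma card_fset_filter (T : choiceType) (A : {fset T}) (P : pred T) :
  #|` [fset x in A | P x]| = (\sum_(x <- A) P x)%N.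
Proof.
rewrite card_fset_sum1 big_fset /= big_mkcond /=.
by apply: eq_bigr => x _; case: (P x).
Qed.

(** Summing over a fixed [G] instead of [X] makes the index range independent of [X], so that sums
    over sets and over points can be exchanged. *)
Lemma card_fset_sum_mem (T : choiceType) (X G : {fset T}) (P : pred T) :
  X `<=` G -> #|` [fset x in X | P x]| = (\sum_(x <- G) (x \in X) && P x)%N.
Proof.
move=> XG; rewrite -card_fset_filter; congr (#|` _|).
apply/fsetP => x; rewrite !inE /=.
by case xX: (x \in X); rewrite ?andbF //= (fsubsetP XG).
Qed.

Lemma card_fsetD1_union_closed (T : choiceType) (A : {fset {fset T}})
    (X : {fset T}) :
  (forall Y Z, Y \in A -> Z \in A -> Y `|` Z \in A) -> X \notin A ->
  (#|` [fset x in X | X `\ x \in A]| <= 1)%N.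
Proof.
move=> UA XA; set E := [fset x in X | _].
have [->|[x xE]] := fset_0Vmem E; first by rewrite cardfs0.
rewrite -(cardfs1 x); apply: fsubset_leq_card; apply/fsubsetP => y yE.
rewrite inE; apply/negPn/negP => yx; move: xE yE; rewrite !inE /=.
move=> /andP[xX Ax] /andP[yX Ay]; move: XA; apply/negP/negPn.
suff -> : X = (X `\ x) `|` (X `\ y) by exact: UA.
(* As [x] and [y] differ, each point of [X] survives in at least one of the two deletions. *)
apply/fsetP => z; rewrite !inE; have [->|] //= := eqVneq z x.
  by rewrite eq_sym yx.
by case: (z \in X); rewrite // andbF.
Qed.

Lemma card_fsetD1_stable (T : choiceType) (B : {fset {fset T}}) (x : T) :
  (\sum_(X <- B) (x \in X) && (X `\ x \in B) <= \sum_(X <- B) (x \notin X))%N.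
Proof.
rewrite -!card_fset_filter; set E := [fset X in B | _ && _].
(* Putting [x] back recovers [X]. *)
have injE : {in E &, injective (fun X : {fset T} => X `\ x)}.
  move=> X Y; rewrite !inE /= => /and3P[_ xX _] /and3P[_ xY _] XY.
  by rewrite -(fsetD1K xX) XY fsetD1K.
rewrite -(card_in_imfset imfset_key injE) /=; apply: fsubset_leq_card.
apply/fsubsetP => Y /imfsetP[X /=]; rewrite !inE /= => /and3P[_ _ XB] ->.
by rewrite XB !inE eqxx.
Qed.

Lemma sum_card_exchange (T : choiceType) (B : {fset {fset T}}) (G : {fset T}) :
  (forall X, X \in B -> X `<=` G) ->
  (\sum_(X <- B) #|` X| = \sum_(x <- G) \sum_(X <- B) (x \in X))%N.
Proof.
move=> BG; rewrite exchange_big /= [LHS]big_seq [RHS]big_seq.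
apply: eq_bigr => X XB; under [RHS]eq_bigr do rewrite -[_ \in X]andbT.
rewrite -(card_fset_sum_mem _ _ _ predT (BG _ XB)); congr (#|` _|).
by apply/fsetP => x; rewrite !inE andbT.
Qed.

Lemma sum_card_compl_union_closed (T : choiceType) (G : {fset T})
    (A : {fset {fset T}}) :
  (forall X Y, X \in A -> Y \in A -> X `|` Y \in A) ->
  (2 * \sum_(X <- fpowerset G `\` A) #|` X|
     <= #|` G|.+1 * #|` fpowerset G `\` A|)%N.
Proof.
move=> UA; set B := fpowerset G `\` A.
have BG X : X \in B -> X `<=` G.
  by rewrite inE fpowersetE => /andP[].
(* The term [#|] B|[pays, for each]X[, for the at most one]x[with]X [\ x] in [A]. *)
have down : (\sum_(X <- B) #|` X| <=
    #|` B| + \sum_(x <- G) \sum_(X <- B) (x \in X) && (X `\ x \in B))%N.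
  rewrite exchange_big /= card_fset_sum1 -big_split /=.
  rewrite [leqLHS]big_seq [leqRHS]big_seq; apply: leq_sum => X XB.
  rewrite -(card_fset_sum_mem _ _ _ (fun x => X `\ x \in B) (BG _ XB)).
  have XA : X \notin A by move: XB; rewrite inE => /andP[].
  rewrite [leqLHS]card_fset_sum1.
  rewrite (big_fsetID _ (fun x => X `\ x \in A)) /= -!card_fset_sum1.
  apply: leq_add; first exact: card_fsetD1_union_closed.
  apply: fsubset_leq_card; apply/fsubsetP => x; rewrite !inE /=.
  case/andP=> xX ->; rewrite xX /= fpowersetE.
  exact: fsubset_trans (fsubD1set _ _) (BG _ XB).
have up : (\sum_(x <- G) \sum_(X <- B) (x \in X) && (X `\ x \in B) +
    \sum_(X <- B) #|` X| <= #|` G| * #|` B|)%N.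
  rewrite (sum_card_exchange _ _ _ BG) -big_split /= -[#|` G|]sum1_size big_distrl /=.
  apply: leq_sum => x _.
  rewrite mul1n card_fset_sum1 (leq_trans (leq_add (card_fsetD1_stable _ _ _) (leqnn _))) //.
  by rewrite -big_split /=; apply: leq_sum => X _; case: (x \in X).
(* Adding [down] and [up] cancels the double sum. *)
by rewrite mulSn; lia.
Qed.

Lemma card_ground n : #|` ground n| = n.
Proof.
rewrite /ground card_fseq undup_id ?size_iota //; exact: iota_uniq.
Qed.

Lemma ground_subset m n : (m <= n)%N -> ground m `<=` ground n.
Proof.
by move=> mn; apply/fsubsetP => k; rewrite !inE /= !mem_iota; lia.
Qed.

Lemma sum_card_cube n (B : setfamily) : B `<=` cube n ->
  (\sum_(1 <= k < n.+1) #|` [fset X in B | k \in X]| = \sum_(X <- B) #|` X|)%N.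
Proof.
move=> Bn; rewrite (sum_card_exchange _ _ (ground n)); last first.
  by move=> X XB; rewrite -fpowersetE (fsubsetP Bn).
under eq_bigr do rewrite card_fset_filter.
(* The enumeration of the finite set [ground n] need not be in increasing order, so the index lists
   are matched up to permutation. *)
apply/perm_big/uniq_perm; rewrite ?iota_uniq ?fset_uniq // => k.
by rewrite !inE /index_iota subn1.
Qed.

Lemma mu_sum_card (R : realType) n (B : setfamily) : B `<=` cube n ->
  mu R n B = (\sum_(X <- B) #|` X|)%N%:R / n%:R.
Proof. by move=> Bn; rewrite /mu sum_card_cube. Qed.

Lemma sum_card_compl_family (R : realType) n (A : setfamily) : union_closed A ->
  (\sum_(X <- compl_family n A) #|` X|)%N%:R
    <= (n%:R + 1) / 2 * #|` compl_family n A|%:R :> R.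
Proof.
move=> UA; have := sum_card_compl_union_closed _ (ground n) A UA.
rewrite card_ground -/(cube n) -/(compl_family n A) /=.
by rewrite -(ler_nat R) !natrM -(natr1 n); lra.
Qed.

Lemma mu_compl_family (R : realType) n (A : setfamily) : (0 < n)%N -> union_closed A ->
  mu R n (compl_family n A)
    <= (n%:R + 1) / (2 * n%:R) * #|` compl_family n A|%:R.
Proof.
move=> n0 UA; rewrite mu_sum_card ?fsubsetDl // ler_pdivrMr ?ltr0n //.
apply: le_trans (sum_card_compl_family R n A UA) _.
rewrite le_eqVlt; apply/orP; left; apply/eqP; field.
by rewrite pnatr_eq0 -lt0n.
Qed.

Lemma mu_quotient_le (R : realType) n (A : setfamily) : (0 < n)%N -> union_closed A ->
  mu R n (compl_family n A) / #|` compl_family n A|%:R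
    <= (n%:R + 1) / (2 * n%:R) :> R.
Proof.
move=> n0 UA; have [->|B0] := eqVneq #|` compl_family n A| 0%N.
  (* For an empty complement the quotient is 0, and the bound is nonnegative. *)
  by rewrite invr0 mulr0 divr_ge0 ?addr_ge0 ?mulr_ge0 ?ler0n.
by rewrite ler_pdivrMr ?ltr0n ?lt0n // mu_compl_family.
Qed.

Lemma finite_set_nat_near (S : set nat) : finite_set S ->
  (\forall l \near \oo, ~ S l)%classic.
Proof.
move=> /finite_seqP[s ->]; exists (\max_(i <- s) i).+1 => // l /= sl ls.
by have := @leq_bigmax_seq _ s xpredT id l ls isT; rewrite leqNgt sl.
Qed.

Lemma near_ground_size_gt (n : nat -> nat) (A : nat -> setfamily) (N : nat) :
  (forall l, A l `<=` cube (n l)) -> injective A ->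
  (\forall l \near \oo, (N < n l)%N)%classic.
Proof.
(* [P] is the finite set of all families on [ground N]; it contains [A l] whenever [n l <= N], and
   injectivity allows only finitely many such [l]. *)
move=> An injA; set P := [set` fpowerset (cube N)]%classic.
have : finite_set (A @^-1` P)%classic.
  by apply: finite_preimage (finite_fset _) => l l' _ _; exact: injA.
move=> /finite_set_nat_near; apply: filterS => l Pl; rewrite ltnNge.
apply/negP => nN; apply: Pl; rewrite /P /= fpowersetE.
by apply: fsubset_trans (An l) _; rewrite fpowersetS ground_subset.
Qed.

(* In the limsup, B_l may be empty (when A_l is the whole power set); the
   quotient then has the value 0 / 0 = 0. The limsup is taken in \bar R. *)
Theorem theorem1 (R : realType) :
  (forall (n : nat) (A B : setfamily),
     (0 < n)%N -> A `<=` cube n -> union_closed A -> B = compl_family n A ->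
     (\sum_(X <- B) #|` X|)%N%:R <= (n%:R + 1) / 2 * #|` B|%:R :> R
     /\ mu R n B <= (n%:R + 1) / (2 * n%:R) * #|` B|%:R)
  /\
  (forall (n : nat -> nat) (A B : nat -> setfamily),
     (forall l, (0 < n l)%N) ->
     (forall l, A l `<=` cube (n l)) ->
     (forall l, union_closed (A l)) ->
     (forall l l', l <> l' -> A l <> A l') ->
     (forall l, B l = compl_family (n l) (A l)) ->
     (limn_esup (fun l => (mu R (n l) (B l) / #|` B l|%:R)%:E)
        <= (1 / 2 : R)%:E)%E).
Proof.
split=> [n A B n0 _ UA ->|n A B n0 An UA neqA BE].
  by split; [exact: sum_card_compl_family | exact: mu_compl_family].
have injA : injective A.
  by move=> l l' All'; apply: contrapT => /neqA.
(* Allow a slack [e] and choose [N] above [1 / e]. *)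
apply/lee_addgt0Pr => e e0; have := archi_boundP (ltW (divr_gt0 ltr01 e0)).
set N := Num.Def.archi_bound _ => Ne.
set u := fun l : nat => _%:E; set V := [set l | (N < n l)%N]%classic.
(* The limsup is an infimum of suprema over neighbourhoods of infinity, so bounding the supremum
   over [V] suffices. *)
apply: (@le_trans _ _ (ereal_sup [set u l | l in V]%classic)).
  apply: ereal_inf_lbound; exists V => //.
  exact: near_ground_size_gt An injA.
apply: ge_ereal_sup => _ [l /= Nl <-].
rewrite /u BE -EFinD lee_fin; apply: le_trans (mu_quotient_le R _ _ (n0 l) (UA l)) _.
have nN : N%:R < (n l)%:R :> R by rewrite ltr_nat.
have : 1 / e < (n l)%:R by exact: lt_trans Ne nN.
(* The bound [(n + 1) / (2 * n)] is 1/2 + 1/(2n), and 1/n < [e]. *)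
rewrite ltr_pdivrMr // => ne; rewrite ler_pdivrMr ?mulr_gt0 ?ltr0n //.
by lra.
Qed.
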